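(* Let $A\in \mathrm{SL}(3,\mathbb{H})$ be a reversible element. Then $A$ is strongly reversible in $\mathrm{SL}(3,\mathbb{H})$ if and only if it is conjugate in $\mathrm{SL}(3,\mathbb{H})$ to one of the following matrices: (i) $\begin{pmatrix} e^{\mathbf{i}\theta}&0&0\\0&e^{\mathbf{i}\theta}&0\\0&0&e^{\mathbf{i}\psi}\end{pmatrix}$, where $\theta\in[0,\pi]$ and $\psi\in\{0,\pi\}$; (ii) $\begin{pmatrix} re^{\mathbf{i}\theta}&0&0\\0&r^{-1}e^{\mathbf{i}\theta}&0\\0&0&e^{\mathbf{i}\psi}\end{pmatrix}$, where $r\in\mathbb{R}$, $r>0$, $r\neq 1$, $\theta\in[0,\pi]$ and $\psi\in\{0,\pi\}$; (iii) $\begin{pmatrix} e^{\mathbf{i}\theta}&1&0\\0&e^{\mathbf{i}\theta}&0\\0&0&e^{\mathbf{i}\psi}\end{pmatrix}$, where $\theta,\psi\in\{0,\pi\}$; (iv) $\begin{pmatrix} e^{\mathbf{i}\theta}&1&0\\0&e^{\mathbf{i}\theta}&1\\0&0&e^{\mathbf{i}\theta}\end{pmatrix}$, where $\theta\in\{0,\pi\}$.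
   Context: $\mathbb{H}$ denotes Hamilton's real quaternions with units $\mathbf{i},\mathbf{j},\mathbf{k}$, and $\mathbb{C}=\mathbb{R}+\mathbb{R}\mathbf{i}\subset\mathbb{H}$. For $A\in \mathrm{M}(3,\mathbb{H})$ write $A=A_1+A_2\mathbf{j}$ with $A_1,A_2\in \mathrm{M}(3,\mathbb{C})$, and put $\det_{\mathbb{H}}(A):=\det\begin{pmatrix} A_1 & A_2\\ -\overline{A_2} & \overline{A_1}\end{pmatrix}$. Put $\mathrm{SL}(3,\mathbb{H})=\{g\in \mathrm{M}(3,\mathbb{H}) : \det_{\mathbb{H}}(g)=1\}$. An element $g$ of a group $G$ is called reversible in $G$ if it is conjugate to $g^{-1}$ in $G$. It is called strongly reversible in $G$ if there is $h\in G$ with $h^2=1$ (order at most $2$) and $hgh^{-1}=g^{-1}$. *)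

(* Defs.v *)
From HB Require Import structures.
From mathcomp Require Import all_boot all_order all_algebra.
From mathcomp Require Import ring.
From mathcomp Require Import complex.
From mathcomp Require Import reals trigo.

Set Implicit Arguments.
Unset Strict Implicit.
Unset Printing Implicit Defensive.

Import GRing.Theory.
Local Open Scope ring_scope.
Local Open Scope complex_scope.

(* Quat a b c d is a + b i + c j + d k. *)
Record quat (R : Type) := Quat { qre : R; qi : R; qj : R; qk : R }.
Add Printing Constructor quat.

Definition quat_to_prod (R : Type) (q : quat R) : R * R * R * R :=
  (qre q, qi q, qj q, qk q).
Definition prod_to_quat (R : Type) (p : R * R * R * R) : quat R :=
  Quat p.1.1.1 p.1.1.2 p.1.2 p.2.
Lemma quat_to_prodK (R : Type) :
  cancel (@quat_to_prod R) (@prod_to_quat R).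
Proof. by case. Qed.

HB.instance Definition _ (R : choiceType) :=
  Choice.copy (quat R) (can_type (@quat_to_prodK R)).

Section QuatRing.
Variable R : rcfType.
Implicit Types x y z : quat R.

Definition addq x y :=
  Quat (qre x + qre y) (qi x + qi y) (qj x + qj y) (qk x + qk y).
Definition oppq x := Quat (- qre x) (- qi x) (- qj x) (- qk x).
Definition zeroq : quat R := Quat 0 0 0 0.
Definition oneq : quat R := Quat 1 0 0 0.
Definition mulq x y :=
  let: Quat a b c d := x in let: Quat a' b' c' d' := y in
  Quat (a * a' - b * b' - c * c' - d * d')
       (a * b' + b * a' + c * d' - d * c')
       (a * c' - b * d' + c * a' + d * b')
       (a * d' + b * c' - c * b' + d * a').

Fact addqA : associative addq.
Proof. by move=> [a b c d] [? ? ? ?] [? ? ? ?]; congr Quat; apply: addrA. Qed.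
Fact addqC : commutative addq.
Proof. by move=> [a b c d] [? ? ? ?]; congr Quat; apply: addrC. Qed.
Fact add0q : left_id zeroq addq.
Proof. by move=> [a b c d]; congr Quat; apply: add0r. Qed.
Fact addNq : left_inverse zeroq oppq addq.
Proof. by move=> [a b c d]; congr Quat; apply: addNr. Qed.

HB.instance Definition _ :=
  GRing.isZmodule.Build (quat R) addqA addqC add0q addNq.

Fact mulqA : associative mulq.
Proof. by move=> [a b c d] [? ? ? ?] [? ? ? ?]; congr Quat; ring. Qed.
Fact mul1q : left_id oneq mulq.
Proof. by move=> [a b c d]; congr Quat; ring. Qed.
Fact mulq1 : right_id oneq mulq.
Proof. by move=> [a b c d]; congr Quat; ring. Qed.
Fact mulqDl : left_distributive mulq +%R.
Proof. by move=> [a b c d] [? ? ? ?] [? ? ? ?]; congr Quat => /=; ring. Qed.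
Fact mulqDr : right_distributive mulq +%R.
Proof. by move=> [a b c d] [? ? ? ?] [? ? ? ?]; congr Quat => /=; ring. Qed.
Fact oneq_neq0 : oneq != 0.
Proof. by apply/eqP => -[/eqP]; rewrite oner_eq0. Qed.

HB.instance Definition _ := GRing.Zmodule_isNzRing.Build (quat R)
  mulqA mul1q mulq1 mulqDl mulqDr oneq_neq0.

Definition real_quat (a : R) : quat R := Quat a 0 0 0.

(* q = z1 + z2 j with z1, z2 in R + R i; since k = i j, the z2 component of
   a + b i + c j + d k is c + d i. *)
Definition cpart1 (q : quat R) : R[i] := qre q +i* qi q.
Definition cpart2 (q : quat R) : R[i] := qj q +i* qk q.
Definition quat_of_cparts (z1 z2 : R[i]) : quat R :=
  Quat (complex.Re z1) (complex.Im z1) (complex.Re z2) (complex.Im z2).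

Fact quat_of_cpartsE (z1 z2 : R[i]) :
  quat_of_cparts z1 z2 =
  quat_of_cparts z1 0 + quat_of_cparts z2 0 * Quat 0 0 1 0.
Proof.
by case: z1 z2 => [a b] [c d]; congr Quat => /=; ring.
Qed.

Fact cpart1D : {morph cpart1 : x y / x + y}. Proof. by []. Qed.
Fact cpart2D : {morph cpart2 : x y / x + y}. Proof. by []. Qed.
Fact cpart1M x y :
  cpart1 (x * y) = cpart1 x * cpart1 y - cpart2 x * (cpart2 y)^*.
Proof.
by case: x y => [a b c d] [a' b' c' d']; congr Complex => /=; ring.
Qed.
Fact cpart2M x y :
  cpart2 (x * y) = cpart1 x * cpart2 y + cpart2 x * (cpart1 y)^*.
Proof.
by case: x y => [a b c d] [a' b' c' d']; congr Complex => /=; ring.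
Qed.
Fact cpartsK x : quat_of_cparts (cpart1 x) (cpart2 x) = x.
Proof. by case: x. Qed.
Fact cpart1K (z1 z2 : R[i]) : cpart1 (quat_of_cparts z1 z2) = z1.
Proof. by case: z1. Qed.
Fact cpart2K (z1 z2 : R[i]) : cpart2 (quat_of_cparts z1 z2) = z2.
Proof. by case: z2. Qed.

End QuatRing.

Section ComplexAdjoint.
Variables (R : rcfType) (n : nat).
Implicit Types A B : 'M[quat R]_n.

Definition cadj A : 'M[R[i]]_(n + n) :=
  let A1 := map_mx (@cpart1 R) A in
  let A2 := map_mx (@cpart2 R) A in
  block_mx A1 A2 (- map_mx conjc A2) (map_mx conjc A1).

Definition detH A : R[i] := \det (cadj A).

Fact cpart1_mulmx A B :
  map_mx (@cpart1 R) (A *m B) =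
  map_mx (@cpart1 R) A *m map_mx (@cpart1 R) B
  - map_mx (@cpart2 R) A *m map_mx conjc (map_mx (@cpart2 R) B).
Proof.
apply/matrixP => i j; rewrite !mxE.
rewrite (big_morph _ (@cpart1D R) (erefl : cpart1 0 = 0)) -sumrB.
by apply: eq_bigr => k _; rewrite cpart1M !mxE.
Qed.

Fact cpart2_mulmx A B :
  map_mx (@cpart2 R) (A *m B) =
  map_mx (@cpart1 R) A *m map_mx (@cpart2 R) B
  + map_mx (@cpart2 R) A *m map_mx conjc (map_mx (@cpart1 R) B).
Proof.
apply/matrixP => i j; rewrite !mxE.
rewrite (big_morph _ (@cpart2D R) (erefl : cpart2 0 = 0)) -big_split /=.
by apply: eq_bigr => k _; rewrite cpart2M !mxE.
Qed.

Fact map_conjcK m p (M : 'M[R[i]]_(m, p)) : map_mx conjc (map_mx conjc M) = M.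
Proof. by apply/matrixP => i j; rewrite !mxE conjcK. Qed.

Fact cadjM A B : cadj (A *m B) = cadj A *m cadj B.
Proof.
rewrite /cadj mulmx_block cpart1_mulmx cpart2_mulmx.
rewrite !(map_mxD, map_mxB, map_mxM) /= !map_conjcK.
congr block_mx.
- by rewrite mulmxN.
- by rewrite opprD addrC mulNmx mulmxN.
- by rewrite addrC mulNmx map_mxN map_mxM /= map_conjcK.
Qed.

Fact cadj1 : cadj 1%:M = 1%:M.
Proof.
rewrite /cadj (_ : map_mx (@cpart1 R) 1%:M = 1%:M); last first.
  by apply/matrixP => i j; rewrite !mxE; case: eqP.
rewrite (_ : map_mx (@cpart2 R) 1%:M = 0); last first.
  by apply/matrixP => i j; rewrite !mxE; case: eqP.
by rewrite !map_mx0 oppr0 map_mx1 -scalar_mx_block.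
Qed.

Fact cadj_inj : injective cadj.
Proof.
move=> A B /eq_block_mx [/matrixP E1 /matrixP E2 _ _].
apply/matrixP => i j; rewrite -[LHS]cpartsK -[RHS]cpartsK.
by have := E1 i j; have := E2 i j; rewrite !mxE => -> ->.
Qed.

Fact detHM A B : detH (A *m B) = detH A * detH B.
Proof. by rewrite /detH cadjM det_mulmx. Qed.

Fact detH1 : detH 1%:M = 1.
Proof. by rewrite /detH cadj1 det1. Qed.

(* Read off the first block row of the inverse of the complex matrix. *)
Definition invmxH A : 'M[quat R]_n :=
  let Y := invmx (cadj A) in
  \matrix_(i, j) quat_of_cparts (ulsubmx Y i j) (ursubmx Y i j).

Let J : 'M[R[i]]_(n + n) := block_mx 0 1%:M (- 1%:M) 0.

Fact cadj_conj A : cadj A *m J = J *m map_mx conjc (cadj A).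
Proof.
rewrite /cadj /J map_block_mx !mulmx_block map_mxN /= !map_conjcK.
by rewrite ?mul0mx ?mulmx0 ?mul1mx ?mulmx1 ?mulNmx ?mulmxN ?mulmx1 ?mul1mx
           ?add0r ?addr0.
Qed.

Fact block_of_conj (Y : 'M[R[i]]_(n + n)) : Y *m J = J *m map_mx conjc Y ->
  Y = block_mx (ulsubmx Y) (ursubmx Y)
        (- map_mx conjc (ursubmx Y)) (map_mx conjc (ulsubmx Y)).
Proof.
move: (submxK Y) => <-.
set P := ulsubmx Y; set Q := ursubmx Y; set S := dlsubmx Y; set T := drsubmx Y.
rewrite block_mxKul block_mxKur /J map_block_mx !mulmx_block.
rewrite !mul0mx !mulmx0 !mul1mx !mulmx1 !mulNmx !mulmxN !mulmx1 !mul1mx.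
rewrite !add0r !addr0.
case/eq_block_mx => EQ EP ET ES.
have -> : T = map_mx conjc P by rewrite EP map_conjcK.
by have -> : S = - map_mx conjc Q by rewrite ES.
Qed.

Fact cadj_invmxH A : detH A \is a GRing.unit ->
  cadj (invmxH A) = invmx (cadj A).
Proof.
move=> uA; have uX : cadj A \in unitmx by [].
rewrite [RHS]block_of_conj; last first.
  apply: (can_inj (mulKmx uX)); rewrite !mulmxA mulmxV // mul1mx.
  by rewrite cadj_conj -mulmxA -map_mxM mulmxV //= map_mx1 mulmx1.
rewrite /cadj /invmxH; congr block_mx; apply/matrixP => i j;
  by rewrite !mxE ?cpart1K ?cpart2K.
Qed.

End ComplexAdjoint.

Section SpecialLinear.
Variables (R : rcfType) (n : nat).

Record SLH := MkSLH { SLH_mx :> 'M[quat R]_n; _ : detH SLH_mx == 1 }.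
HB.instance Definition _ := [isSub for SLH_mx].
HB.instance Definition _ := [Choice of SLH by <:].

Implicit Types g h : SLH.

Fact detH_SLH g : detH g = 1. Proof. exact/eqP/(valP g). Qed.

Fact SLH_mulP g h : detH (SLH_mx g *m SLH_mx h) == 1.
Proof. by rewrite detHM !detH_SLH mulr1. Qed.
Fact SLH_oneP : detH (1%:M : 'M[quat R]_n) == 1.
Proof. by rewrite detH1. Qed.
Fact SLH_invP g : detH (invmxH g) == 1.
Proof.
by rewrite /detH cadj_invmxH ?detH_SLH ?unitr1 // det_inv -/(detH g) detH_SLH invr1.
Qed.

Definition SLH_mul g h := MkSLH (SLH_mulP g h).
Definition SLH_one := MkSLH SLH_oneP.
Definition SLH_inv g := MkSLH (SLH_invP g).

Fact SLH_mulA : associative SLH_mul.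
Proof. by move=> f g h; apply: val_inj; apply: mulmxA. Qed.
Fact SLH_mul1 : left_id SLH_one SLH_mul.
Proof. by move=> g; apply: val_inj; apply: mul1mx. Qed.
Fact SLH_mulr1 : right_id SLH_one SLH_mul.
Proof. by move=> g; apply: val_inj; apply: mulmx1. Qed.
Fact SLH_mulV : left_inverse SLH_one SLH_inv SLH_mul.
Proof.
move=> g; apply: val_inj; apply: cadj_inj; rewrite cadjM cadj1.
have ug : detH g \is a GRing.unit by rewrite detH_SLH unitr1.
by rewrite cadj_invmxH // mulVmx.
Qed.
Fact SLH_mulrV : right_inverse SLH_one SLH_inv SLH_mul.
Proof.
move=> g; apply: val_inj; apply: cadj_inj; rewrite cadjM cadj1.
have ug : detH g \is a GRing.unit by rewrite detH_SLH unitr1.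
by rewrite cadj_invmxH // mulmxV.
Qed.

HB.instance Definition _ :=
  isGroup.Build SLH SLH_mulA SLH_mul1 SLH_mulr1 SLH_mulV SLH_mulrV.

End SpecialLinear.

Section Reversibility.
Variable G : groupType.

Definition conjugate (g g' : G) : Prop := exists h : G, (h * g * h^-1 = g')%g.

Definition reversible (g : G) : Prop := conjugate g (g^-1)%g.

Definition strongly_reversible (g : G) : Prop :=
  exists h : G, (h ^+ 2 = 1 /\ h * g * h^-1 = g^-1)%g.

End Reversibility.

Definition mx3 (T : Type) (a11 a12 a13 a21 a22 a23 a31 a32 a33 : T) : 'M[T]_3 :=
  \matrix_(i, j) tnth [tuple tnth [tuple a11; a12; a13] j;
                             tnth [tuple a21; a22; a23] j;
                             tnth [tuple a31; a32; a33] j] i.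

(* e^(i t) in R + R i, seen inside the quaternions *)
Definition expi (R : realType) (t : R) : quat R := Quat (cos t) (sin t) 0 0.

(* Main.v *)
Require Import Defs.
From HB Require Import structures.
From mathcomp Require Import all_boot all_order all_algebra.
From mathcomp Require Import ring lra.
From mathcomp Require Import complex reals sequences trigo exp.

Set Implicit Arguments.
Unset Strict Implicit.
Unset Printing Implicit Defensive.

Import Order.TTheory GRing.Theory Num.Theory.
Local Open Scope ring_scope.

(* Let h be an involution with h A h = A^-1.  Over a division ring h is
   diagonalizable with entries 1 and -1, so up to replacing h by -h and changing
   basis either h = 1, and A is itself an involution, or h = diag(1, 1, -1).  In
   the latter case (h A)^2 = 1, written entrywise, leaves very little freedom:
   normalizing the off-diagonal column of A to (1, 0) and its last entry s to a
   complex number gives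
       A = [s, b, 1; 0, e, 0; s^2 - 1, (s + e) b, s],   e = 1 or -1,
   whose first and third basis vectors span a complex block of trace 2s and
   determinant 1.  If s^2 <> 1 this block has eigenvalues z and 1/z, and A is
   conjugate to diag(z, 1/z, e); if s^2 = 1 the matrix is, up to sign,
   unipotent or has a Jordan block of size 2.  If the off-diagonal column
   vanishes, the off-diagonal row plays its role.

   Conjugation in GL(3, H) becomes conjugation in SL(3, H) after scaling by a
   positive real, because detH is positive on invertible matrices: it is real,
   and by Gaussian elimination every invertible matrix is a product of squares. *)

(** * The division ring of quaternions: square roots and conjugation into the complex numbers *)

Section QuaternionInverse.
Variable R : rcfType.
Implicit Types x y : quat R.

Definition normq2 x : R := qre x ^+ 2 + qi x ^+ 2 + qj x ^+ 2 + qk x ^+ 2.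

Lemma normq2_ge0 x : 0 <= normq2 x.
Proof. by rewrite !addr_ge0 ?sqr_ge0. Qed.

Lemma normq2_eq0 x : (normq2 x == 0) = (x == 0).
Proof.
case: x => a b c d; rewrite /normq2 /=.
rewrite !paddr_eq0 ?addr_ge0 ?sqr_ge0 // !sqrf_eq0.
apply/idP/eqP => [/andP[/andP[/andP[/eqP-> /eqP->] /eqP->] /eqP->] //|].
by case=> -> -> -> ->; rewrite eqxx.
Qed.

(** The conjugate of [x] over its squared norm; inversion has to fix non-units, hence the value [0]
    at [0]. *)
Definition invq x : quat R :=
  if x == 0 then 0 else
  let n := (normq2 x)^-1 in
  Quat (n * qre x) (- (n * qi x)) (- (n * qj x)) (- (n * qk x)).

Fact mulVq : {in [pred x | x != 0], left_inverse 1 invq *%R}.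
Proof.
move=> x; rewrite inE /invq => x0; rewrite (negPf x0).
have := x0; rewrite -normq2_eq0; case: x {x0} => a b c d; rewrite /normq2 /= => n0.
by congr Quat => /=; field.
Qed.

Fact mulqV : {in [pred x | x != 0], right_inverse 1 invq *%R}.
Proof.
move=> x; rewrite inE /invq => x0; rewrite (negPf x0).
have := x0; rewrite -normq2_eq0; case: x {x0} => a b c d; rewrite /normq2 /= => n0.
by congr Quat => /=; field.
Qed.

Fact unitq x y : y * x = 1 /\ x * y = 1 -> x != 0.
Proof. by case=> yx _; apply: contra_eq_neq yx => ->; rewrite mulr0 eq_sym oner_eq0. Qed.

Fact invq_out : {in [predC [pred x | x != 0]], invq =1 id}.
Proof. by move=> x; rewrite !inE negbK /invq => /eqP->; rewrite eqxx. Qed.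

HB.instance Definition _ :=
  GRing.NzRing_hasMulInverse.Build (quat R) mulVq mulqV unitq invq_out.

Lemma mulq_eq0 x y : (x * y == 0) = (x == 0) || (y == 0).
Proof.
apply/idP/idP => [/eqP xy0|/orP[]/eqP->]; rewrite ?mul0r ?mulr0 //.
by case: eqVneq => //= x0; rewrite -(mulKr (x := x) x0 y) xy0 mulr0.
Qed.

Lemma sqrq_eq1 x : x * x = 1 -> x = 1 \/ x = -1.
Proof.
move=> xx; have /eqP: (x - 1) * (x + 1) = 0.
  by rewrite mulrDr mulr1 mulrBl mul1r xx addrA subrK subrr.
by rewrite mulq_eq0 subr_eq0 addr_eq0 => /orP[]/eqP; [left|right].
Qed.

(* If [N] is the norm of [x], then [(x + N)^2 = 2 (Re x + N) x], which gives a
   square root unless [x] is a nonpositive real. *)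
Lemma quat_sqrt x : exists y, x = y * y.
Proof.
have n0 := normq2_ge0 x; set N := Num.sqrt (normq2 x).
have NN : N ^+ 2 = normq2 x by rewrite sqr_sqrtr.
have N0 : 0 <= N by apply: sqrtr_ge0.
case: (ltP 0 (qre x + N)) => [p|np].
  set s := Num.sqrt (2 * (qre x + N)).
  have ss : s ^+ 2 = 2 * (qre x + N) by rewrite sqr_sqrtr // mulr_ge0 // ltW.
  have s0 : s != 0 by apply: contraTneq p => s0; rewrite -leNgt; nra.
  exists (Quat ((qre x + N) / s) (qi x / s) (qj x / s) (qk x / s)).
  move: NN ss s0 p; rewrite /normq2 {N0 n0}; move: N s => N s.
  case: x => a b c d /= NN ss s0 p.
  have p0 : a + N != 0 by rewrite gt_eqF.
  (* As [s ^+ 2 = 2 * (a + N)], this recovers each imaginary coordinate of the square. *)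
  have D v : (a + N) / s * (v / s) *+ 2 = v.
    rewrite [LHS](_ : _ = 2 * (a + N) * v / s ^+ 2); last by field.
    by rewrite ss; field.
  congr Quat => /=.
  - rewrite [RHS](_ : _ = ((a + N) ^+ 2 - (b ^+ 2 + c ^+ 2 + d ^+ 2)) / s ^+ 2); last by field.
    rewrite [_ + d ^+ 2](_ : _ = N ^+ 2 - a ^+ 2) ?ss; last by rewrite NN; ring.
    by field.
  1-3: by rewrite -[LHS]D; ring.
(* Here [N] is at most minus the real part, so the imaginary part vanishes and a real multiple of i
   is a root. *)
have qN : 0 <= - qre x by nra.
exists (Quat 0 (Num.sqrt (- qre x)) 0 0).
have : 0 <= qi x ^+ 2 /\ 0 <= qj x ^+ 2 /\ 0 <= qk x ^+ 2 by rewrite !sqr_ge0.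
case: x @N n0 NN N0 np qN => a b c d; rewrite /normq2 /= => n0; move: (Num.sqrt _) => N NN N0 np qN.
case=> b0 [c0 d0].
have := sqr_sqrtr qN; move: (Num.sqrt _) => t tt.
have NN' : N ^+ 2 <= a ^+ 2 by nra.
have [b1 [c1 d1]] : b ^+ 2 = 0 /\ c ^+ 2 = 0 /\ d ^+ 2 = 0 by split; [|split]; nra.
move/eqP: b1; rewrite sqrf_eq0 => /eqP->; move/eqP: c1; rewrite sqrf_eq0 => /eqP->.
move/eqP: d1; rewrite sqrf_eq0 => /eqP->.
by congr Quat => /=; rewrite ?(mul0r,mulr0,addr0,subr0,oppr0,add0r) // -expr2 tt opprK.
Qed.

Local Notation j := (Quat 0 0 1 0 : quat R).

Lemma real_quat_comm (a : R) x : real_quat a * x = x * real_quat a.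
Proof. by case: x => b c d e; congr Quat => /=; ring. Qed.

Lemma quat_halves : real_quat (2^-1) + real_quat (2^-1) = 1 :> quat R.
Proof. by congr Quat => /=; field. Qed.

Definition cquat (z : R[i]) : quat R := quat_of_cparts z 0.

Lemma cquatD z w : cquat (z + w) = cquat z + cquat w.
Proof. by case: z w => [a b] [c d]; congr Quat => /=; rewrite addr0. Qed.
Lemma cquatN z : cquat (- z) = - cquat z.
Proof. by case: z => [a b]; congr Quat => /=; rewrite oppr0. Qed.
Lemma cquatM z w : cquat (z * w) = cquat z * cquat w.
Proof. by case: z w => [a b] [c d]; congr Quat => /=; ring. Qed.
Lemma cquat1 : cquat 1 = 1. Proof. by []. Qed.
Lemma cquat0 : cquat 0 = 0. Proof. by []. Qed.

Lemma cquat_conj z : j * cquat z = cquat (conjc z) * j.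
Proof. by case: z => a b; congr Quat => /=; ring. Qed.

(* For [v] the imaginary part of [x] and [m] its norm, [u = m - i v] satisfies
   [u v = (m i) u]; it vanishes only for [v = - m i], where [j] does the job. *)
Lemma quat_conj_complex x : exists u z, u != 0 /\ u * x = cquat z * u.
Proof.
case: x => a b c d; have m0 : 0 <= b ^+ 2 + c ^+ 2 + d ^+ 2 by rewrite !addr_ge0 ?sqr_ge0.
set m := Num.sqrt (b ^+ 2 + c ^+ 2 + d ^+ 2); have mm := sqr_sqrtr m0; rewrite -/m in mm.
case: (eqVneq (Quat (m + b) 0 d (- c)) 0) => [[mb d0 c0]|u0].
  exists j, (Complex a m); split; first by apply/eqP => -[/eqP]; rewrite oner_eq0.
  have -> : b = - m by lra.
  have -> : c = 0 by lra.
  by rewrite d0; congr Quat => /=; ring.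
exists (Quat (m + b) 0 d (- c)), (Complex a m); split=> //.
have mm' : m * m = b ^+ 2 + c ^+ 2 + d ^+ 2 by rewrite -mm; ring.
congr Quat => /=; first by ring.
- transitivity (m * b + (b ^+ 2 + c ^+ 2 + d ^+ 2)); first by ring.
  by rewrite -mm'; ring.
- by ring.
- by ring.
Qed.

End QuaternionInverse.

(** * Quaternionic matrices and positivity of [detH] by elimination *)

Section QuaternionMatrices.
Variable R : rcfType.
Implicit Types n k : nat.

(** The entries do not commute, so the claim is transported to complex matrices by the injective
    multiplicative map [cadj]. *)
Lemma mulmx1H n (P Q : 'M[quat R]_n) : Q *m P = 1%:M -> P *m Q = 1%:M.
Proof.
move=> QP; apply: cadj_inj; rewrite cadjM cadj1; apply: mulmx1C.
by rewrite -cadjM QP cadj1.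
Qed.

(** The invertible matrix [J] makes [cadj A] similar to its complex conjugate, so the determinant is
    real. *)
Lemma detH_conj n (A : 'M[quat R]_n) : conjc (detH A) = detH A.
Proof.
set J : 'M[R[i]]_(n + n) := block_mx 0 1%:M (- 1%:M) 0.
have JJ : J *m block_mx 0 (- 1%:M) 1%:M 0 = 1%:M.
  rewrite mulmx_block !(mul0mx, mulmx0, mulmxN, mulNmx, mul1mx, add0r, addr0).
  by rewrite opprK -scalar_mx_block.
have /(congr1 determinant) := cadj_conj A.
rewrite -/J !det_mulmx [RHS]mulrC => /mulIf E; rewrite /detH {2}E ?det_map_mx //.
apply: contra_eq_neq (congr1 determinant JJ) => J0.
by rewrite det_mulmx J0 mul0r det1 eq_sym oner_eq0.
Qed.

Lemma detH_scale n (c : R) (A : 'M[quat R]_n) :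
  detH ((real_quat c)%:M *m A) = (c%:C ^+ (n + n))%C * detH A.
Proof.
rewrite detHM; congr (_ * _); rewrite -det_scalar /detH; congr (\det _).
rewrite /cadj [RHS]scalar_mx_block.
have -> : map_mx (@cpart1 R) (real_quat c)%:M = (c%:C)%C%:M :> 'M_n.
  by apply/matrixP => i j; rewrite !mxE; case: eqP.
have -> : map_mx (@cpart2 R) (real_quat c)%:M = 0 :> 'M_n.
  by apply/matrixP => i j; rewrite !mxE; case: eqP.
rewrite map_mx0 oppr0 map_scalar_mx /=; congr block_mx.
by rewrite oppr0.
Qed.

(* On this class [detH] is visibly nonnegative; it is shown below to contain all
   invertible matrices. *)
Inductive square_product n : 'M[quat R]_n -> Prop :=
| SquareProductSqr S : square_product (S *m S)
| SquareProductMul A B :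
    square_product A -> square_product B -> square_product (A *m B).

Lemma square_product1 n : square_product (1%:M : 'M[quat R]_n).
Proof. by rewrite -[1%:M]mulmx1; constructor. Qed.

Lemma square_product_lift n (A : 'M[quat R]_n) :
  square_product A -> square_product (block_mx (1%:M : 'M_1) 0 0 A).
Proof.
have E (B C : 'M[quat R]_n) : block_mx (1%:M : 'M_1) 0 0 (B *m C) =
    block_mx 1%:M 0 0 B *m block_mx 1%:M 0 0 C.
  by rewrite mulmx_block !mul0mx !mulmx0 !mulmx1 !addr0 add0r.
elim=> [S|B C _ hB _ hC]; rewrite E; first exact: SquareProductSqr.
exact: SquareProductMul.
Qed.

Lemma detH_square_product n (A : 'M[quat R]_n) : square_product A -> 0 <= detH A.
Proof.
elim=> [S|B C _ hB _ hC]; rewrite detHM; last exact: mulr_ge0.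
by rewrite -{1}detH_conj mulrC; apply: mul_conjC_ge0.
Qed.

Lemma lower_mul n (c d : 'cV[quat R]_n) :
  block_mx 1%:M 0 c 1%:M *m block_mx 1%:M 0 d 1%:M = block_mx 1%:M 0 (c + d) 1%:M.
Proof. by rewrite mulmx_block !mul0mx !mulmx0 !mul1mx !mulmx1 !addr0 ?add0r. Qed.

Lemma upper_mul n (c d : 'rV[quat R]_n) :
  block_mx 1%:M c 0 1%:M *m block_mx 1%:M d 0 1%:M = block_mx 1%:M (d + c) 0 1%:M.
Proof. by rewrite mulmx_block !mul0mx !mulmx0 !mul1mx !mulmx1 !addr0 ?add0r. Qed.

Lemma mx_halves m n (c : 'M[quat R]_(m, n)) :
  c = real_quat 2^-1 *: c + real_quat 2^-1 *: c.
Proof. by rewrite -scalerDl quat_halves scale1r. Qed.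

(** Such matrices multiply by adding their columns, so each is the square of the one with half the
    column. *)
Lemma lower_square_product n (c : 'cV[quat R]_n) :
  square_product (block_mx 1%:M 0 c 1%:M).
Proof.
by rewrite (mx_halves c) -lower_mul; apply: SquareProductSqr.
Qed.

Lemma upper_square_product n (c : 'rV[quat R]_n) :
  square_product (block_mx 1%:M c 0 1%:M).
Proof.
by rewrite (mx_halves c) -upper_mul; apply: SquareProductSqr.
Qed.

Lemma diag_square_product n (q : quat R) :
  square_product (block_mx (q%:M : 'M_1) 0 0 (1%:M : 'M_n)).
Proof.
have [y ->] := quat_sqrt q.
rewrite scalar_mxM -[X in block_mx _ _ _ X]mulmx1.
rewrite [X in square_product X](_ : _ = block_mx (y%:M : 'M_1) 0 0 (1%:M : 'M_n)
   *m block_mx (y%:M : 'M_1) 0 0 (1%:M : 'M_n)); first exact: SquareProductSqr.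
by rewrite mulmx_block !mul0mx !mulmx0 !mulmx1 !addr0 ?add0r.
Qed.

Lemma row_nonzero_corner n (w : 'rV[quat R]_(1 + n)) : w != 0 ->
  exists c : 'cV_n, lsubmx (w *m block_mx 1%:M 0 c 1%:M) 0 0 != 0.
Proof.
rewrite -[w]hsubmxK; set a := lsubmx w; set b := rsubmx w => w0.
have E c : lsubmx (row_mx a b *m block_mx 1%:M 0 c 1%:M) = a + b *m c.
  by rewrite mul_row_block row_mxKl mulmx1.
case: (eqVneq (a 0 0) 0) => a0; last first.
  by exists 0; rewrite E mulmx0 addr0.
have {}a0 : a = 0 by apply/matrixP => i j; rewrite !ord1 a0 mxE.
have /rV0Pn [i bi] : b != 0.
  by apply: contraNneq w0 => b0; rewrite a0 b0 row_mx0.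
exists (delta_mx i 0); rewrite E a0 add0r mxE (bigD1 i) //= big1 => [|j ji].
  by rewrite [delta_mx _ _ _ _]mxE !eqxx mulr1 addr0.
by rewrite [delta_mx _ _ _ _]mxE (negPf ji) mulr0.
Qed.

Lemma block_LDU n (a : quat R) (b : 'rV[quat R]_n) (c : 'cV[quat R]_n) d : a != 0 ->
  block_mx (a%:M : 'M_1) b c d =
  block_mx 1%:M 0 (c *m (a^-1)%:M) 1%:M *m
  (block_mx a%:M 0 0 1%:M *m block_mx 1%:M 0 0 (d - c *m (a^-1)%:M *m b) *m
  block_mx 1%:M ((a^-1)%:M *m b) 0 1%:M).
Proof.
move=> a0; rewrite !mulmx_block !(mul0mx, mulmx0, mul1mx, mulmx1, add0r, addr0).
congr block_mx; first by rewrite mulmxA -scalar_mxM divrr // mul1mx.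
  by rewrite -mulmxA -scalar_mxM mulVr // mulmx1.
rewrite [a%:M *m _]mulmxA -scalar_mxM divrr // mul1mx.
by rewrite addrC subrK.
Qed.

(** Gaussian elimination: a column operation makes the corner nonzero, and [block_LDU] then leaves
    triangular factors, a diagonal factor and a smaller block for the induction. *)
Lemma invertible_square_product n (P Q : 'M[quat R]_n) :
  Q *m P = 1%:M -> square_product P.
Proof.
elim: n P Q => [|n IH] P Q QP.
  by rewrite (_ : P = 1%:M); [apply: square_product1|apply/matrixP => -[]].
have PQ := mulmx1H QP.
have r0 : row 0 P != 0.
  apply/eqP => r0; have /(congr1 (row 0)) := PQ; rewrite row_mul r0 mul0mx.
  by move/rowP/(_ 0); rewrite !mxE eqxx => /eqP; rewrite eq_sym oner_eq0.
have [c] := row_nonzero_corner r0; set T := block_mx _ _ c _.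
set T' : 'M[quat R]_(1 + n) := block_mx 1%:M 0 (- c) 1%:M.
have TT' : T *m T' = 1%:M by rewrite lower_mul subrr -scalar_mx_block.
have T'T := mulmx1H TT'.
rewrite -row_mul; set P1 : 'M_(1 + n) := P *m T.
have -> : lsubmx (row 0 P1) 0 0 = ulsubmx P1 0 0.
  by move: P1 => P1; rewrite !mxE; congr (P1 _ _); apply/val_inj.
move=> a0.
suff sP1 : square_product P1.
  have -> : P = P1 *m T' by rewrite /P1 -mulmxA TT' mulmx1.
  by apply: SquareProductMul => //; apply: lower_square_product.
have /(congr1 (mulmx^~ T))/(congr1 (mulmx T')) : Q *m P = 1%:M by [].
rewrite mul1mx T'T -mulmxA -/P1 mulmxA.
move: (T' *m Q) => Q1; move: P1 a0; clear -IH => P.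
rewrite -[P]submxK block_mxKul; move: (ulsubmx P) (ursubmx P) (dlsubmx P) (drsubmx P).
move=> a b c d; rewrite [a]mx11_scalar; move: (a 0 0) => {}a.
rewrite mxE eqxx mulr1n => a0.
rewrite (block_LDU _ _ _ a0); set L := block_mx 1%:M 0 _ _; set U := block_mx 1%:M (_ *m b) _ _.
set D := block_mx _ _ _ 1%:M; set e := d - _; set E := block_mx 1%:M 0 0 e => QP.
have U1 : U *m block_mx 1%:M (- ((a^-1)%:M *m b)) 0 1%:M = 1%:M.
  by rewrite upper_mul addNr -scalar_mx_block.
(* Conjugation by [U] moves the last factor to the front, so [E], and with it the block [e], has a
   left inverse. *)
move: QP; rewrite !mulmxA => /(congr1 (mulmx U))/(congr1 (mulmx^~ _)) => /(_ _ (block_mx 1%:M (- ((a^-1)%:M *m b)) 0 1%:M)).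
rewrite mulmx1 U1 -!mulmxA U1 mulmx1 !mulmxA; move: (U *m Q1 *m L *m D) => X.
rewrite -[X]submxK /E mulmx_block !(mul0mx, mulmx0, mulmx1, addr0, add0r).
rewrite scalar_mx_block => /eq_block_mx [_ _ _ Xe].
apply: SquareProductMul; last exact: upper_square_product.
apply: SquareProductMul; last by apply: square_product_lift; exact: IH Xe.
apply: SquareProductMul; last exact: diag_square_product.
exact: lower_square_product.
Qed.

Lemma detH_gt0 n (P Q : 'M[quat R]_n) : Q *m P = 1%:M ->
  exists2 d : R, 0 < d & detH P = (d%:C)%C.
Proof.
move=> QP; have := detH_square_product (invertible_square_product QP).
have : detH P != 0.
  by apply: contra_eq_neq (congr1 (@detH R n) QP) => P0;
     rewrite detHM P0 mulr0 detH1 eq_sym oner_eq0.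
case: (detH P) => a b; rewrite lecE /= => n0 /andP[/eqP b0 a0].
exists a; last by rewrite b0.
rewrite lt_neqAle a0 andbT; apply: contraNneq n0 => a0'.
by rewrite -a0' b0.
Qed.

(** The determinant squares to 1 and is positive. Hence a reversing involution lies in SL(n, H)
    automatically. *)
Lemma detH_involution n (h : 'M[quat R]_n) : h *m h = 1%:M -> detH h = 1.
Proof.
move=> hh; have [d d0 E] := detH_gt0 hh; rewrite E.
have /eqP := congr1 (@detH R n) hh; rewrite detHM detH1 -expr2 sqrf_eq1 E.
by case/orP=> /eqP // [d1 _]; move: d0; rewrite d1 oppr_gt0 ltr10.
Qed.

End QuaternionMatrices.

(** * Conjugacy in GL(n, H) and diagonalization of involutions *)

Section Similarity.
Variable R : rcfType.
Implicit Types n k : nat.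

Definition similarH n (A B : 'M[quat R]_n) :=
  exists P Q, Q *m P = 1%:M /\ P *m A = B *m P.

Lemma similar_refl n (A : 'M[quat R]_n) : similarH A A.
Proof. by exists 1%:M, 1%:M; rewrite !mulmx1 mul1mx. Qed.

Lemma similar_trans n (B A C : 'M[quat R]_n) :
  similarH A B -> similarH B C -> similarH A C.
Proof.
move=> [P [Q [QP PA]]] [P' [Q' [QP' PB]]]; exists (P' *m P), (Q *m Q').
split; last by rewrite -mulmxA PA mulmxA PB mulmxA.
by rewrite -mulmxA [Q' *m _]mulmxA QP' mul1mx.
Qed.

Lemma similar_conj n (P Q A : 'M[quat R]_n) : Q *m P = 1%:M ->
  similarH A (P *m A *m Q).
Proof. by move=> QP; exists P, Q; split; rewrite // -[RHS]mulmxA QP mulmx1. Qed.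

(** Serves to complete a left eigenvector to a basis. *)
Lemma row_basis n (w : 'rV[quat R]_(1 + n)) : w != 0 ->
  exists P Q : 'M[quat R]_(1 + n), Q *m P = 1%:M /\ usubmx P = w.
Proof.
move=> w0; have [c] := row_nonzero_corner w0.
set T := block_mx _ _ _ _; set T' : 'M[quat R]_(1 + n) := block_mx 1%:M 0 (- c) 1%:M.
have TT' : T *m T' = 1%:M by rewrite lower_mul subrr -scalar_mx_block.
set v := w *m T; move=> v0.
have -> : w = v *m T' by rewrite -mulmxA TT' mulmx1.
move: v v0 => v; rewrite -[v]hsubmxK row_mxKl.
move: (lsubmx v) (rsubmx v) => a b; rewrite [a]mx11_scalar.
move: (a 0 0) => {}a; rewrite mxE eqxx mulr1n => a0.
exists (block_mx a%:M b 0 1%:M *m T'), (T *m block_mx (a^-1)%:M (- ((a^-1)%:M *m b)) 0 1%:M).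
split; last first.
  by rewrite /T' mulmx_block /block_mx col_mxKu mul_row_block.
rewrite -mulmxA [X in T *m X]mulmxA [X in X *m T']mulmx_block.
rewrite !(mul0mx, mulmx0, mulmx1, addr0, add0r) -scalar_mxM mulVr // subrr.
by rewrite -scalar_mx_block mul1mx.
Qed.

Definition sign_diag n k : 'M[quat R]_n :=
  \matrix_(i, j) if i == j then (if (i < k)%N then 1 else - 1) else 0.

Lemma sign_diag0 n : sign_diag n 0 = - 1%:M.
Proof. by apply/matrixP => i j; rewrite !mxE; case: eqP; rewrite ?oppr0. Qed.

Lemma sign_diagS n k : sign_diag (1 + n) k.+1 = block_mx 1%:M 0 0 (sign_diag n k).
Proof.
apply/matrixP => i j; rewrite !mxE.
case: splitP => i' Ei; rewrite !mxE; case: splitP => j' Ej; rewrite !mxE.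
- by rewrite -(inj_eq val_inj) /= Ei Ej !ord1.
- by rewrite -(inj_eq val_inj) /= Ei Ej !ord1.
- by rewrite -(inj_eq val_inj) /= Ei Ej !ord1.
by rewrite -(inj_eq val_inj) /= Ei Ej /= !add1n eqSS ltnS (inj_eq val_inj).
Qed.

Lemma similar_lift n (A B : 'M[quat R]_n) : similarH A B ->
  similarH (block_mx (1%:M : 'M_1) 0 0 A) (block_mx 1%:M 0 0 B).
Proof.
move=> [P [Q [QP PA]]]; exists (block_mx 1%:M 0 0 P), (block_mx 1%:M 0 0 Q).
by rewrite !mulmx_block !(mul0mx, mulmx0, mulmx1, addr0, add0r) QP PA -scalar_mx_block.
Qed.

(** A nonzero row of [1%:M + h] is fixed by [h]; as first basis vector it makes [h] block lower
    triangular with corner 1, and induction handles the remaining block. *)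
Lemma involution_sign_diag n (h : 'M[quat R]_n) : h *m h = 1%:M ->
  exists2 k, (k <= n)%N & similarH h (sign_diag n k).
Proof.
elim: n h => [|n IH] h hh.
  by exists 0%N => //; rewrite (_ : h = sign_diag 0 0); [apply: similar_refl|apply/matrixP => -[]].
case: (eqVneq (1%:M + h) 0) => [h1|h1].
  exists 0%N => //; rewrite sign_diag0 (_ : h = - 1%:M); first exact: similar_refl.
  by apply/eqP; rewrite -addr_eq0 addrC h1.
have [i wi] : exists i, row i (1%:M + h) != 0.
  apply/existsP; rewrite -negb_forall; apply: contra h1 => /forallP w0.
  by apply/eqP/row_matrixP => i; rewrite row0; apply/eqP.
have [P [Q [QP Pw]]] := row_basis wi.
have wh : row i (1%:M + h) *m h = row i (1%:M + h).
  by rewrite -row_mul mulmxDl mul1mx hh addrC.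
have hS := similar_conj h QP.
set g := P *m h *m Q in hS.
have gg : g *m g = 1%:M.
  by rewrite /g mulmxA -[P *m h *m Q *m _]mulmxA [Q *m _]mulmxA QP mul1mx -[P *m h *m h]mulmxA hh mulmx1 mulmx1H.
have gu : usubmx g = row_mx 1%:M 0.
  rewrite /g -mulmxA -[P]vsubmxK mul_col_mx col_mxKu Pw mulmxA wh -Pw.
  have := mulmx1H QP; rewrite -{1}[P]vsubmxK mul_col_mx scalar_mx_block.
  by move=> /(congr1 usubmx); rewrite col_mxKu /block_mx col_mxKu.
rewrite -[g]vsubmxK gu -[dsubmx g]hsubmxK -/(block_mx _ _ _ _) in hS gg.
move: (lsubmx _) (rsubmx _) hS gg => c h' hS.
rewrite mulmx_block !(mul0mx, mulmx0, mulmx1, addr0, add0r) scalar_mx_block.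
move=> /eq_block_mx [_ _ ch hh'].
have [k kn hk] := IH _ hh'; exists k.+1 => //; rewrite sign_diagS.
apply: similar_trans hS _; apply: similar_trans (similar_lift hk).
have h'c : h' *m c = - c by apply/eqP; rewrite -addr_eq0 addrC ch.
(* Since [h' *m c = - c], half of [- c] satisfies [x + c = h' *m x], which is what clears the
   column. *)
set x := - (c *m (real_quat 2^-1)%:M).
have xx : x + x = - c.
  by rewrite -opprD -mulmxDr -raddfD /= quat_halves mulmx1.
exists (block_mx 1%:M 0 x 1%:M), (block_mx 1%:M 0 (- x) 1%:M).
rewrite lower_mul addNr -scalar_mx_block; split=> //.
rewrite !mulmx_block !(mul0mx, mulmx0, mul1mx, mulmx1, addr0, add0r).
have h'x : h' *m x = - x by rewrite /x mulmxN mulmxA h'c mulNmx.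
by congr block_mx; rewrite h'x -[c]opprK -xx opprD addrA subrr add0r.
Qed.

End Similarity.

(** * Entrywise computation with 3 by 3 matrices *)

Section MatrixEntries.
Variable R : rcfType.
Local Notation H := (quat R).

Lemma mx3_eta (A : 'M[H]_3) : A = mx3 (A 0 0) (A 0 1) (A 0 2%:R)
  (A 1 0) (A 1 1) (A 1 2%:R) (A 2%:R 0) (A 2%:R 1) (A 2%:R 2%:R).
Proof.
apply/matrixP => -[[|[|[|//]]] i] [[|[|[|//]]] k]; rewrite !mxE /=;
  by congr (A _ _); apply/val_inj.
Qed.

Lemma mx3M (a b c d e f g h i a' b' c' d' e' f' g' h' i' : H) :
  mx3 a b c d e f g h i *m mx3 a' b' c' d' e' f' g' h' i' =
  mx3 (a * a' + b * d' + c * g') (a * b' + b * e' + c * h') (a * c' + b * f' + c * i')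
      (d * a' + e * d' + f * g') (d * b' + e * e' + f * h') (d * c' + e * f' + f * i')
      (g * a' + h * d' + i * g') (g * b' + h * e' + i * h') (g * c' + h * f' + i * i').
Proof.
by apply/matrixP => -[[|[|[|//]]] p] [[|[|[|//]]] q];
  rewrite mxE !big_ord_recr big_ord0 /= !mxE /= add0r.
Qed.

Lemma mx3_1 : 1%:M = mx3 1 0 0 0 1 0 0 0 1 :> 'M[H]_3.
Proof. by apply/matrixP => -[[|[|[|//]]] p] [[|[|[|//]]] q]; rewrite !mxE. Qed.

Lemma mx3_inj (a b c d e f g h i a' b' c' d' e' f' g' h' i' : H) :
  mx3 a b c d e f g h i = mx3 a' b' c' d' e' f' g' h' i' ->
  [/\ [/\ a = a', b = b' & c = c'], [/\ d = d', e = e' & f = f'] &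
      [/\ g = g', h = h' & i = i']].
Proof.
move=> /matrixP E.
have := E 0 0; have := E 0 1; have := E 0 2%:R; have := E 1 0; have := E 1 1.
have := E 1 2%:R; have := E 2%:R 0; have := E 2%:R 1; have := E 2%:R 2%:R.
by rewrite !mxE /=.
Qed.

End MatrixEntries.

Local Ltac quat_simp := rewrite ?(mul0r, mulr0, mul1r, mulr1, addr0, add0r, mulN1r,
  mulrN1, oppr0, opprK, subrr, addNr, subr0, sub0r) //.
Local Ltac mx3_simp := rewrite ?mx3M ?mx3_1; congr mx3; quat_simp.

(** * Reduction of explicit families of matrices to normal form *)

Section NormalForms.
Variable R : rcfType.
Local Notation H := (quat R).
Local Notation j := (Quat 0 0 1 0 : H).

(* With [z = r e^(i theta)], [(conj z)^-1 = r^-1 e^(i theta)], so the first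
   alternative covers both (i) and (ii). *)
Definition normal_form (B : 'M[H]_3) := exists (d e : H),
  (d = 1 \/ d = -1) /\ (e = 1 \/ e = -1) /\
  [\/ exists z : R[i], [/\ z != 0, 0 <= complex.Im z &
         B = mx3 (cquat z) 0 0 0 (cquat (conjc z)^-1) 0 0 0 e],
      B = mx3 d 1 0 0 d 0 0 0 e
    | B = mx3 d 1 0 0 d 1 0 0 d].

Definition has_normal_form A := exists2 B, similarH A B & normal_form B.

Lemma has_normal_form_similar A B :
  similarH A B -> has_normal_form B -> has_normal_form A.
Proof. by move=> AB [C BC nC]; exists C => //; apply: similar_trans BC. Qed.

(** Conjugation by [j] turns a complex entry into its conjugate; it is applied to the second entry
    if the imaginary part of [z] is nonnegative, and to the first otherwise. *)
Lemma diag_normal_form (z : R[i]) (e : H) : z != 0 -> e = 1 \/ e = -1 ->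
  has_normal_form (mx3 (cquat z) 0 0 0 (cquat z^-1) 0 0 0 e).
Proof.
move=> z0 he.
case: (leP 0 (complex.Im z)) => iz.
  exists (mx3 (cquat z) 0 0 0 (cquat (conjc z)^-1) 0 0 0 e); last first.
    by exists 1, e; split; [left|split=> //; constructor 1; exists z].
  exists (mx3 1 0 0 0 j 0 0 0 1), (mx3 1 0 0 0 (-j) 0 0 0 1); split; mx3_simp.
    by congr Quat => /=; ring.
  by rewrite cquat_conj; congr (cquat _ * _); rewrite rmorphV ?unitfE.
exists (mx3 (cquat (conjc z)) 0 0 0 (cquat z^-1) 0 0 0 e); last first.
  exists 1, e; split; [by left|split=> //; constructor 1; exists (conjc z)].
  by rewrite conjcK fmorph_eq0; split=> //; case: (z) iz => a b /=; rewrite oppr_ge0 => /ltW.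
exists (mx3 j 0 0 0 1 0 0 0 1), (mx3 (-j) 0 0 0 1 0 0 0 1); split; mx3_simp.
  by congr Quat => /=; ring.
by rewrite cquat_conj.
Qed.

Lemma cquat_sign (e : H) : e = 1 \/ e = -1 ->
  exists2 w : R[i], e = cquat w & w = 1 \/ w = -1.
Proof.
by case=> ->; [exists 1; [|left]|exists (-1); [rewrite cquatN|right]].
Qed.

(** The eigenvalues [z + x], [z - x] and [w] are pairwise distinct and the first two are mutually
    inverse, so the matrix can be diagonalized. *)
Lemma complex_block_normal_form (z x w : R[i]) (b : H) :
  x != 0 -> x * x = z * z - 1 -> w = 1 \/ w = -1 ->
  has_normal_form (mx3 (cquat z) b 1 0 (cquat w) 0
    (cquat (z * z - 1)) (cquat (z + w) * b) (cquat z)).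
Proof.
move=> x0 xx hw.
have ww : w * w = 1 by case: hw => ->; ring.
have zx : (z + x) * (z - x) = 1 by transitivity (z * z - x * x); [ring|rewrite xx; ring].
(* If [z + y = w], then its inverse [z - y] is [w] as well, which forces [y = 0]. *)
have nz y : y * y = z * z - 1 -> y != 0 -> z + y - w != 0.
  move=> yy; apply: contra_neq => zyw; have zw : z + y = w by apply/eqP; rewrite -subr_eq0 zyw.
  have E : w * (z - y) = 1 by rewrite -zw; transitivity (z * z - y * y); [ring|rewrite yy; ring].
  have {}E : z - y = w by rewrite -[LHS]mul1r -ww -mulrA E mulr1.
  have : y *+ 2 = 0 by transitivity ((z + y) - (z - y)); [ring|rewrite zw E subrr].
  by move/eqP; rewrite mulrn_eq0 => /eqP.
have wC (y : H) : y * cquat w = cquat w * y.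
  by case: hw => ->; rewrite ?cquatN cquat1 ?mulrN1 ?mulN1r ?mulr1 ?mul1r.
apply: has_normal_form_similar (diag_normal_form (z := z + x) (e := cquat w) _ _); last first.
- by case: hw => ->; [left|right; rewrite cquatN].
- by apply: contra_eq_neq zx => ->; rewrite mul0r eq_sym oner_eq0.
have -> : (z + x)^-1 = z - x.
  by apply: (mulIf (x := z + x)); [apply: contra_eq_neq zx => ->; rewrite mul0r eq_sym oner_eq0|
     rewrite mulVf 1?mulrC ?zx //; apply: contra_eq_neq zx => ->; rewrite mul0r eq_sym oner_eq0].
(* [cquat (t y) * b] is the middle coordinate of the left eigenvector for the eigenvalue [z + y]. *)
pose t y := (z + y + w) / (z + y - w).
have tE y : y * y = z * z - 1 -> y != 0 -> y + w * t y + (z + w) = (z + y) * t y.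
  move=> yy y0; have := nz y yy y0; rewrite /t => n.
  by field.
have xN : (- x) * (- x) = z * z - 1 by rewrite -xx; ring.
have x0' : - x != 0 by rewrite oppr_eq0.
pose y := cquat (t x) * b; pose y' := cquat (t (- x)) * b.
have bE v : v * v = z * z - 1 -> v != 0 ->
    cquat v * b + cquat (t v) * b * cquat w + cquat (z + w) * b =
    cquat (z + v) * (cquat (t v) * b).
  by move=> vv v0; rewrite wC !mulrA -!cquatM -!mulrDl -!cquatD tE.
(* The rows [(x, y, 1)], [(-x, y', 1)] and [(0, 1, 0)] are left eigenvectors. *)
exists (mx3 (cquat x) y 1 (cquat (- x)) y' 1 0 1 0),
  (mx3 (cquat (x^-1 / 2)) (- cquat (x^-1 / 2)) (- (cquat (x^-1 / 2) * (y - y')))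
       0 0 1 (cquat 2^-1) (cquat 2^-1) (- (cquat 2^-1 * (y + y')))); split; mx3_simp.
- by rewrite -cquatN -!cquatM -cquatD -[RHS]cquat1; congr cquat; field.
- by rewrite mulNr -mulrBr subrr.
- by rewrite -!cquatM -cquatD mulrN subrr.
- by rewrite -mulrDr subrr.
- by rewrite -cquatD -[RHS]cquat1; congr cquat; field.
- by rewrite -!cquatM -cquatD; congr cquat; rewrite [RHS]mulrDl xx; ring.
- exact: bE.
- by rewrite -cquatD addrC.
- by rewrite -!cquatM -cquatD; congr cquat; transitivity (x * x - z * x); [rewrite xx|]; ring.
- exact: bE.
- by rewrite -cquatD addrC.
Qed.

Lemma half_double (b : H) : real_quat 2^-1 * b + real_quat 2^-1 * b = b.
Proof. by rewrite -mulrDl quat_halves mul1r. Qed.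

(** Either [(d + e) * b] vanishes and a Jordan block of size 2 splits off, or [e = d] and [b] is
    nonzero, which gives a Jordan block of size 3. *)
Lemma unipotent_block_normal_form (d e b : H) : d = 1 \/ d = -1 -> e = 1 \/ e = -1 ->
  has_normal_form (mx3 d b 1 0 e 0 0 ((d + e) * b) d).
Proof.
move=> hd he.
have dC (y : H) : y * d = d * y.
  by case: hd => ->; rewrite ?mulrN1 ?mulN1r ?mulr1 ?mul1r.
have dd : d * d = 1 by case: hd => ->; rewrite ?mulrN1 ?opprK ?mulr1.
case: (eqVneq ((d + e) * b) 0) => [deb|].
  exists (mx3 d 1 0 0 d 0 0 0 e); last by exists d, e; do 2!split=> //; constructor 2.
  (* This solves [b + y * e = d * y], because [e = - d] or [b = 0]. *)
  pose y : H := d * (real_quat 2^-1 * b).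
  exists (mx3 1 y 0 0 0 1 0 1 0), (mx3 1 0 (- y) 0 0 1 0 1 0); rewrite deb.
  split; mx3_simp.
  suff : y * e = - (d * y) \/ b = 0.
    case=> [->|b0]; last by rewrite /y b0 !(mulr0, mul0r, addr0).
    by rewrite -[X in X - _](half_double b) /y mulrA dd mul1r addrK.
  move/eqP: deb; rewrite mulq_eq0 => /orP[|/eqP ->]; last by right.
  by rewrite addrC addr_eq0 => /eqP ->; left; rewrite mulrN dC.
rewrite mulq_eq0 negb_or => /andP[de b0].
have ed : e = d.
  by case: hd he de => -> [] ->; rewrite ?subrr ?addNr ?eqxx.
rewrite {}ed in he de *.
exists (mx3 d 1 0 0 d 1 0 0 d); last by exists d, d; do 2!split=> //; constructor 3.
set c := (d + d) * b; have c0 : c != 0 by rewrite mulq_eq0 negb_or de.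
(* The rows are the Jordan chain obtained from (1, 0, 0) by repeatedly applying the matrix minus
   [d]. *)
exists (mx3 1 0 0 0 b 1 0 c 0), (mx3 1 0 0 0 0 c^-1 0 1 (- (b * c^-1))).
split; mx3_simp.
- by rewrite mulVr.
- by rewrite mulNr mulrVK // subrr.
- by rewrite dC.
Qed.

(** The relation forces [c = 0] or [e = - d]; in both cases [c] can be cleared, leaving a Jordan
    block of size 2. *)
Lemma lower_unipotent_normal_form (d e c : H) : d = 1 \/ d = -1 -> e = 1 \/ e = -1 ->
  c * d + e * c = 0 -> has_normal_form (mx3 d 0 0 c e 0 1 0 d).
Proof.
move=> hd he ce.
have dd : d * d = 1 by case: hd => ->; rewrite ?mulrN1 ?opprK ?mulr1.
exists (mx3 d 1 0 0 d 0 0 0 e); last by exists d, e; do 2!split=> //; constructor 2.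
(* Chosen so that [y * d + c = e * y]. *)
pose y : H := - (d * (real_quat 2^-1 * c)).
exists (mx3 0 0 1 1 0 0 y 1 0), (mx3 0 1 0 0 (- y) 1 1 0 0).
split; mx3_simp.
have {ce} : c = 0 \/ e = - d.
  case: hd he ce {dd y} => -> [] ->; quat_simp; try by right; rewrite ?opprK.
  - by move=> E; left; rewrite -(half_double c) -mulrDr E mulr0.
  - by move=> E; left; apply: oppr_inj; rewrite oppr0 -(half_double (- c)) -mulrDr E mulr0.
case=> [c0|->]; first by rewrite /y c0 !(mulr0, oppr0, mul0r, addr0).
rewrite /y mulNr mulNr mulrN opprK [d * (d * _)]mulrA dd mul1r.
have -> : d * (real_quat 2^-1 * c) * d = real_quat 2^-1 * c.
  by case: hd => ->; quat_simp.
by rewrite -[X in _ + X](half_double c) addrA addNr add0r.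
Qed.

(** * Normal forms of matrices reversed by an involution *)

Local Notation D := (mx3 1 0 0 0 1 0 0 0 (-1) : 'M[H]_3).

(* For an involution [h], this says that [h A h] is the inverse of [A]. *)
Definition reversed_by n (h A : 'M[H]_n) := h *m A *m (h *m A) = 1%:M.

Lemma reversed_by_conj n (h h' A P Q : 'M[H]_n) : Q *m P = 1%:M ->
  P *m h = h' *m P -> reversed_by h A -> reversed_by h' (P *m A *m Q).
Proof.
rewrite /reversed_by => QP Ph hA; rewrite !mulmxA -Ph.
rewrite -[_ *m Q *m h']mulmxA -[P *m h *m A *m (Q *m h')]mulmxA.
have -> : Q *m h' = h *m Q.
  by rewrite -[LHS]mulmx1 -(mulmx1H QP) mulmxA -[_ *m h' *m P]mulmxA -Ph mulmxA QP mul1mx.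
rewrite !mulmxA -[_ *m Q *m P]mulmxA QP mulmx1 -!mulmxA.
rewrite [h *m (A *m (h *m (A *m Q)))](_ : _ = h *m A *m (h *m A) *m Q); last by rewrite !mulmxA.
by rewrite hA mul1mx mulmx1H.
Qed.

Lemma unit_column_normal_form (a b c d r1 r2 s : H) :
  reversed_by D (mx3 a b 1 c d 0 r1 r2 s) -> has_normal_form (mx3 a b 1 c d 0 r1 r2 s).
Proof.
rewrite /reversed_by !mx3M mx3_1 => /mx3_inj; quat_simp.
case=> -[aa ab as_] [_ cd c0] _.
rewrite {}c0 !(mul0r, mulr0, addr0, add0r) in aa cd *.
have {as_} sa : s = a by apply/eqP; rewrite eq_sym -subr_eq0 as_.
have {aa} r1E : r1 = a * a - 1 by rewrite -aa opprB addrC subrK.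
have {ab} r2E : r2 = a * b + b * d by apply/eqP; rewrite eq_sym -subr_eq0 ab.
have hd := sqrq_eq1 cd.
(* Scalar conjugation by [u] makes [a] complex and keeps the entry 1 and the central [d]. *)
have [u [z [u0 uz]]] := quat_conj_complex a.
have dC (y : H) : y * d = d * y.
  by case: hd => ->; rewrite ?mulrN1 ?mulN1r ?mulr1 ?mul1r.
pose b' : H := u * b * u^-1.
have [w dw hw] := cquat_sign hd.
apply: (has_normal_form_similar (B := mx3 (cquat z) b' 1 0 (cquat w) 0
    (cquat (z * z - 1)) (cquat (z + w) * b') (cquat z))).
  exists (mx3 u 0 0 0 u 0 0 0 u), (mx3 u^-1 0 0 0 u^-1 0 0 0 u^-1).
  split; mx3_simp; rewrite ?mulVr //.
  - by rewrite /b' mulrVK.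
  - by rewrite -dw dC.
  - rewrite r1E cquatD cquatM cquatN cquat1 mulrBr mulrBl mulr1 mul1r.
    by rewrite -mulrA -uz !mulrA -uz.
  - rewrite r2E dC -mulrDl cquatD -dw /b' -[RHS]mulrA mulrVK // !mulrA.
    by congr (_ * b); rewrite mulrDr mulrDl -uz dC.
  - by rewrite sa.
case: (eqVneq (z * z) 1) => [zz|zz].
  rewrite zz subrr cquat0 cquatD -dw.
  apply: unipotent_block_normal_form => //.
  by apply: sqrq_eq1; rewrite -cquatM zz.
have x2 := sqrtCK (z * z - 1); rewrite expr2 in x2.
apply: complex_block_normal_form x2 hw.
by rewrite sqrtC_eq0 subr_eq0.
Qed.

Lemma unit_row_normal_form (a b c d s : H) :
  reversed_by D (mx3 a b 0 c d 0 1 0 s) -> has_normal_form (mx3 a b 0 c d 0 1 0 s).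
Proof.
rewrite /reversed_by !mx3M mx3_1 => /mx3_inj; quat_simp.
case=> -[aa _ _] [cd dd _] [as_ b0 _].
have {}b0 : b = 0 by apply: oppr_inj; rewrite b0 oppr0.
rewrite b0 !(mul0r, mulr0, addr0, add0r) in aa dd *.
have -> : s = a by apply/eqP; rewrite -subr_eq0 addrC as_.
exact: lower_unipotent_normal_form (sqrq_eq1 aa) (sqrq_eq1 dd) cd.
Qed.

Lemma sign_diag3 k : sign_diag R 3 k = mx3 (if (0 < k)%N then 1 else -1) 0 0
  0 (if (1 < k)%N then 1 else -1) 0 0 0 (if (2 < k)%N then 1 else -1).
Proof. by apply/matrixP => -[[|[|[|//]]] p] [[|[|[|//]]] q]; rewrite !mxE. Qed.

(** Every signature is diag(z, 1/z, e) with z = 1 or -1, after swapping the outer entries of diag(1,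
    -1, -1). *)
Lemma involution_normal_form (A : 'M[H]_3) : A *m A = 1%:M -> has_normal_form A.
Proof.
move=> AA; have [k _ Ak] := involution_sign_diag AA.
apply: has_normal_form_similar Ak _; rewrite sign_diag3.
have D1 (e : H) := @diag_normal_form 1 e (oner_neq0 _).
have DN (e : H) := @diag_normal_form (-1) e.
rewrite oppr_eq0 oner_eq0 !invrN !invr1 !cquatN !cquat1 in D1 DN.
case: k => [|[|[|k]]] /=.
- by apply: DN => //; right.
- apply: has_normal_form_similar (DN 1 _ _) => //; last by left.
  by exists (mx3 0 0 1 0 1 0 1 0 0), (mx3 0 0 1 0 1 0 1 0 0); split; mx3_simp.
- by apply: D1; right.
- by apply: D1; left.
Qed.

Lemma signed_normal_form (A : 'M[H]_3) : reversed_by D A -> has_normal_form A.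
Proof.
move=> DA; have PC (P Q : 'M[H]_3) : Q *m P = 1%:M ->
    has_normal_form (P *m A *m Q) -> has_normal_form A.
  by move=> QP; apply: has_normal_form_similar; apply: similar_conj.
have PD (P Q : 'M[H]_3) (QP : Q *m P = 1%:M) (PD : P *m D = D *m P) :=
  reversed_by_conj QP PD DA.
(* These matrices commute with [D], so conjugating by an invertible one preserves the relation while
   changing the off-diagonal column and row. *)
pose blk (p q r s : H) := mx3 p q 0 r s 0 0 0 1.
have blkD p q r s : blk p q r s *m D = D *m blk p q r s by rewrite /blk; mx3_simp.
move: DA PC PD; rewrite [A]mx3_eta.
move: (A 0 0) (A 0 1) (A 0 2%:R) (A 1 0) (A 1 1) (A 1 2%:R) (A 2%:R 0) (A 2%:R 1) (A 2%:R 2%:R).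
move=> {A} a b q1 c d q2 r1 r2 s DA PC PD.
have column p q r t p' q' r' t' : blk p' q' r' t' *m blk p q r t = 1%:M ->
    p * q1 + q * q2 = 1 -> r * q1 + t * q2 = 0 ->
    has_normal_form (mx3 a b q1 c d q2 r1 r2 s).
  move=> QP E1 E0; apply: (PC _ _ QP).
  move: (PD _ _ QP (blkD _ _ _ _)); rewrite /blk !mx3M; quat_simp.
  by rewrite E1 E0; apply: unit_column_normal_form.
case: (eqVneq q1 0) => [q10|q10]; last first.
  apply: (column q1^-1 0 (- (q2 * q1^-1)) 1 q1 0 q2 1).
  - by rewrite /blk; mx3_simp; rewrite ?divrr // subrr.
  - by quat_simp; rewrite mulVr.
  - by rewrite mulNr mulrVK // mul1r addNr.
case: (eqVneq q2 0) => [q20|q20]; last first.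
  apply: (column 0 q2^-1 1 0 0 1 q2 0).
  - by rewrite /blk; mx3_simp; rewrite divrr.
  - by quat_simp; rewrite mulVr.
  - by quat_simp.
rewrite {}q10 {}q20 {column} in DA PC PD *.
have row p q r t p' q' r' t' : blk p' q' r' t' *m blk p q r t = 1%:M ->
    r1 * p' + r2 * r' = 1 -> r1 * q' + r2 * t' = 0 ->
    has_normal_form (mx3 a b 0 c d 0 r1 r2 s).
  move=> QP E1 E0; apply: (PC _ _ QP).
  move: (PD _ _ QP (blkD _ _ _ _)); rewrite /blk !mx3M; quat_simp.
  by rewrite E1 E0; apply: unit_row_normal_form.
case: (eqVneq r1 0) => [r10|r10]; last first.
  apply: (row r1 r2 0 1 r1^-1 (- (r1^-1 * r2)) 0 1).
  - by rewrite /blk; mx3_simp; rewrite ?mulVr // subrr.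
  - by quat_simp; rewrite divrr.
  - by rewrite mulrN mulrA divrr // mul1r mulr1 addNr.
case: (eqVneq r2 0) => [r20|r20]; last first.
  apply: (row 0 r2 1 0 0 1 r2^-1 0).
  - by rewrite /blk; mx3_simp; rewrite mulVr.
  - by quat_simp; rewrite divrr.
  - by quat_simp.
(* Now the matrix is block diagonal and commutes with [D], so the relation says that its square is
   1. *)
apply: involution_normal_form; move: DA; rewrite /reversed_by r10 r20 !mx3M mx3_1.
by quat_simp; rewrite ?mulrN ?mulNr ?opprK.
Qed.

Lemma strongly_reversible_normal_form (A h : 'M[H]_3) :
  h *m h = 1%:M -> reversed_by h A -> has_normal_form A.
Proof.
move=> hh hA; have [k k3 [P [Q [QP Ph]]]] := involution_sign_diag hh.
apply: has_normal_form_similar (similar_conj A QP) _.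
have {hA hh} := reversed_by_conj QP Ph hA; move: (P *m A *m Q) => {QP Ph}A.
(* The relation is quadratic in the involution, so a sign change reduces zero or one plus sign to
   three or two. *)
have revN (g : 'M[H]_3) : reversed_by g A -> reversed_by (- g) A.
  by rewrite /reversed_by !mulNmx mulmxN opprK.
rewrite sign_diag3; case: k k3 => [|[|[|[|//]]]] _ /= gA.
- apply: involution_normal_form; move/revN: gA.
  rewrite (_ : - mx3 _ _ _ _ _ _ _ _ _ = 1%:M); first by rewrite /reversed_by !mul1mx.
  by apply/matrixP => -[[|[|[|//]]] p] [[|[|[|//]]] q]; rewrite !mxE /= ?opprK ?oppr0.
- pose T : 'M[H]_3 := mx3 0 0 1 0 1 0 1 0 0.
  have TT : T *m T = 1%:M by rewrite /T; mx3_simp.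
  apply: has_normal_form_similar (similar_conj A TT) _.
  apply: signed_normal_form; apply: reversed_by_conj TT _ (revN _ gA).
  rewrite (_ : - mx3 _ _ _ _ _ _ _ _ _ = mx3 (-1) 0 0 0 1 0 0 0 1).
    by rewrite /T; mx3_simp.
  by apply/matrixP => -[[|[|[|//]]] p] [[|[|[|//]]] q]; rewrite !mxE /= ?opprK ?oppr0.
- exact: signed_normal_form.
- apply: involution_normal_form; move: gA.
  by rewrite -mx3_1 /reversed_by !mul1mx.
Qed.

End NormalForms.

(** * Passage from GL(n, H) to SL(n, H) *)

Lemma conjugate_SLH (R : realType) n (A : SLH R n.+1) (B : 'M[quat R]_n.+1) :
  similarH A B -> exists2 B' : SLH R n.+1, conjugate A B' & SLH_mx B' = B.
Proof.
move=> [P [Q [QP PA]]]; have PQ := mulmx1H QP.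
have BE : P *m A *m Q = B by rewrite PA -mulmxA PQ mulmx1.
have detB : detH B == 1.
  by rewrite -BE !detHM mulrAC -detHM PQ detH1 mul1r detH_SLH.
have [d d0 dE] := detH_gt0 QP.
set m := (n.+1 + n.+1)%N; have m0 : (m%:R : R) != 0 by rewrite pnatr_eq0.
(* [detH] is homogeneous of degree [m] under real scaling, so the scalar is the positive [m]-th root
   of [d^-1]. *)
pose c := expR (- (ln d / m%:R)).
have cE : c ^+ m = d^-1.
  by rewrite -expRM_natl mulrN mulrC divfK // expRN lnK.
have hP : detH ((real_quat c)%:M *m P) == 1.
  rewrite detH_scale dE; have := congr1 (real_complex R) cE.
  rewrite rmorphXn fmorphV /= => ->.
  by rewrite mulVf // -[0]/((0 : R)%:C)%C (inj_eq (fmorph_inj _)) gt_eqF.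
exists (MkSLH detB) => //; exists (MkSLH hP).
set h := MkSLH hP; rewrite (_ : (h * A)%g = (MkSLH detB * h)%g) ?mulgK //.
apply: val_inj; rewrite /= -mulmxA PA !mulmxA; congr (_ *m P).
apply/matrixP => i j; rewrite !mxE (bigD1 i) //= big1 => [|k ki]; last first.
  by rewrite mxE eq_sym (negPf ki) mul0r.
rewrite (bigD1 j) //= big1 => [|k kj]; last first.
  by rewrite [X in _ * X]mxE (negPf kj) mulr0.
by rewrite !mxE !eqxx !addr0 real_quat_comm.
Qed.

Lemma involution_strongly_reversible (R : realType) n (A : SLH R n) (h : 'M[quat R]_n) :
  h *m h = 1%:M -> reversed_by h A -> strongly_reversible A.
Proof.
move=> hh hA; have h1 : detH h == 1 by rewrite detH_involution.
have e2 : (MkSLH h1 * MkSLH h1 = 1)%g by apply: val_inj.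
exists (MkSLH h1); split; first by rewrite expg2.
have -> : ((MkSLH h1)^-1 = MkSLH h1)%g by apply: (mulgI (MkSLH h1)); rewrite e2 mulgV.
apply: (mulIg A); rewrite mulVg -mulgA; apply: val_inj.
exact: hA.
Qed.

Lemma strongly_reversible_conjugate (G : groupType) (g g' : G) :
  conjugate g g' -> strongly_reversible g' -> strongly_reversible g.
Proof.
move=> [k <-] [h [h2 hE]]; exists (k^-1 * h * k)%g; split.
  by rewrite expg2 !mulgA mulgK -[(_ * h * h)%g]mulgA -expg2 h2 mulg1 mulVg.
transitivity (k^-1 * (h * (k * g * k^-1) * h^-1) * k)%g.
  by rewrite !invgM invgK !mulgA.
by rewrite hE !invgM invgK !mulgA mulVg mul1g -mulgA mulVg mulg1.
Qed.

(** * The listed matrices and explicit involutions reversing them *)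

Section ListedForms.
Variable R : realType.
Local Notation H := (quat R).
Local Notation j := (Quat 0 0 1 0 : H).

Lemma expi0 : expi (0 : R) = 1. Proof. by rewrite /expi cos0 sin0. Qed.
Lemma expipi : expi (pi : R) = -1.
Proof. by rewrite /expi cospi sinpi; congr Quat; rewrite oppr0. Qed.

Lemma sign_expi (e : H) : e = 1 \/ e = -1 -> exists2 psi : R, psi = 0 \/ psi = pi & e = expi psi.
Proof. by case=> ->; [exists 0; rewrite ?expi0|exists pi; rewrite ?expipi]; auto. Qed.

Lemma expi_sign (psi : R) : psi = 0 \/ psi = pi -> expi psi = 1 \/ expi psi = -1.
Proof. by case=> ->; rewrite ?expi0 ?expipi; auto. Qed.

(** The angle is an arccosine: on [0, pi] the sine is nonnegative, which matches the sign of the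
    imaginary part. *)
Lemma upper_half_polar (z : R[i]) : z != 0 -> 0 <= complex.Im z ->
  exists r theta : R, [/\ 0 < r, 0 <= theta <= pi,
    cquat z = real_quat r * expi theta &
    cquat (conjc z)^-1 = real_quat r^-1 * expi theta].
Proof.
case: z => a b z0 /= b0.
have n0 : 0 < a ^+ 2 + b ^+ 2.
  rewrite lt_neqAle addr_ge0 ?sqr_ge0 // andbT eq_sym paddr_eq0 ?sqr_ge0 // !sqrf_eq0.
  by apply: contraNN z0 => /andP[/eqP -> /eqP ->].
set r := Num.sqrt (a ^+ 2 + b ^+ 2).
have r0 : 0 < r by rewrite sqrtr_gt0.
have rr : r ^+ 2 = a ^+ 2 + b ^+ 2 by rewrite sqr_sqrtr // ltW.
have ar : -1 <= a / r <= 1.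
  by rewrite ler_pdivlMr // ler_pdivrMr //; apply/andP; split; nra.
exists r, (acos (a / r)).
have cosE : cos (acos (a / r)) = a / r by rewrite acosK.
have sinE : sin (acos (a / r)) = b / r.
  rewrite sin_acos // (_ : 1 - (a / r) ^+ 2 = (b / r) ^+ 2).
    by rewrite sqrtr_sqr ger0_norm // divr_ge0 // ltW.
  by rewrite !expr_div_n -[X in X - _](divff (expf_neq0 2 (lt0r_neq0 r0))) rr; ring.
have r0' : r != 0 by rewrite gt_eqF.
have -> : (conjc (Complex a b))^-1 = Complex (a / r ^+ 2) (b / r ^+ 2).
  apply: (mulIf (x := conjc (Complex a b))); first by rewrite fmorph_eq0.
  rewrite mulVf ?fmorph_eq0 //.
  have E : (a ^+ 2 + b ^+ 2) / r ^+ 2 = 1 by rewrite -rr divff // expf_neq0.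
  by congr Complex => /=; [rewrite -E|]; ring.
split=> //; first by rewrite acos_ge0 ?acos_lepi.
  by congr Quat; rewrite /= cosE sinE; field.
by rewrite /expi cosE sinE; congr Quat => /=; field.
Qed.

Lemma normal_form_listed (B : SLH R 3) : normal_form (SLH_mx B) ->
  [\/ exists theta psi : R,
        [/\ 0 <= theta <= pi, psi = 0 \/ psi = pi &
            SLH_mx B = mx3 (expi theta) 0 0 0 (expi theta) 0 0 0 (expi psi)],
      exists r theta psi : R,
        [/\ 0 < r, r != 1, 0 <= theta <= pi, psi = 0 \/ psi = pi &
            SLH_mx B = mx3 (real_quat r * expi theta) 0 0
                           0 (real_quat r^-1 * expi theta) 0 0 0 (expi psi)],
      exists theta psi : R,
        [/\ theta = 0 \/ theta = pi, psi = 0 \/ psi = pi &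
            SLH_mx B = mx3 (expi theta) 1 0 0 (expi theta) 0 0 0 (expi psi)]
    | exists theta : R, (theta = 0 \/ theta = pi) /\
            SLH_mx B = mx3 (expi theta) 1 0 0 (expi theta) 1 0 0 (expi theta)].
Proof.
case=> d [e [/sign_expi [theta ht ->] [/sign_expi [psi hpsi ->]]]].
case=> [[z [z0 iz ->]]|->|->].
- have [r [t [r0 ht' -> ->]]] := upper_half_polar z0 iz.
  case: (eqVneq r 1) => [->|r1]; last by constructor 2; exists r, t, psi.
  by constructor 1; exists t, psi; split=> //; rewrite invr1 !mul1r.
- by constructor 3; exists theta, psi.
- by constructor 4; exists theta.
Qed.

(** The antidiagonal block exchanges the factors [r] and [r^-1], while [j] conjugates the phase,
    that is, inverts it. *)
Lemma diag_reversed (r theta : R) (e : H) : r != 0 -> e = 1 \/ e = -1 ->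
  reversed_by (mx3 0 j 0 (- j) 0 0 0 0 1) (mx3 (real_quat r * expi theta) 0 0
    0 (real_quat r^-1 * expi theta) 0 0 0 e).
Proof.
move=> r0 he; rewrite /reversed_by; mx3_simp.
- have := cos2Dsin2 theta; rewrite /expi.
  by move: (cos _) (sin _) => x y xy; congr Quat => /=; rewrite -?[RHS]xy; field.
- have := cos2Dsin2 theta; rewrite /expi.
  by move: (cos _) (sin _) => x y xy; congr Quat => /=; rewrite -?[RHS]xy; field.
- by case: he => ->; quat_simp.
Qed.

(** Changing the sign of the second basis vector negates the off-diagonal 1; [d] and [e] are their
    own inverses. *)
Lemma jordan2_reversed (d e : H) : d = 1 \/ d = -1 -> e = 1 \/ e = -1 ->
  reversed_by (mx3 1 0 0 0 (-1) 0 0 0 1) (mx3 d 1 0 0 d 0 0 0 e).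
Proof. by case=> -> [] ->; rewrite /reversed_by; mx3_simp. Qed.

(** The inverse of [d + N] is [d - N + d * N ^ 2]: the sign change yields [d - N], and the entry [d]
    of the involution accounts for the last term. *)
Lemma jordan3_reversed (d : H) : d = 1 \/ d = -1 ->
  reversed_by (mx3 1 d 0 0 (-1) 0 0 0 1) (mx3 d 1 0 0 d 1 0 0 d).
Proof. by case=> ->; rewrite /reversed_by; mx3_simp; rewrite opprD addrA subrr add0r addNr. Qed.

End ListedForms.

Theorem theorem3p8 (R : realType) (A : SLH R 3) (hA : reversible A) :
  strongly_reversible A <->
  exists B : SLH R 3, conjugate A B /\
  [\/ (* (i) *)
      exists theta psi : R,
        [/\ 0 <= theta <= pi, psi = 0 \/ psi = pi &
            SLH_mx B = mx3 (expi theta) 0 0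
                           0 (expi theta) 0
                           0 0 (expi psi)],
      (* (ii) *)
      exists r theta psi : R,
        [/\ 0 < r, r != 1, 0 <= theta <= pi, psi = 0 \/ psi = pi &
            SLH_mx B = mx3 (real_quat r * expi theta) 0 0
                           0 (real_quat r^-1 * expi theta) 0
                           0 0 (expi psi)],
      (* (iii) *)
      exists theta psi : R,
        [/\ theta = 0 \/ theta = pi, psi = 0 \/ psi = pi &
            SLH_mx B = mx3 (expi theta) 1 0
                           0 (expi theta) 0
                           0 0 (expi psi)]
    | (* (iv) *)
      exists theta : R,
        (theta = 0 \/ theta = pi) /\
            SLH_mx B = mx3 (expi theta) 1 0
                           0 (expi theta) 1
                           0 0 (expi theta)].
Proof.
split=> [[h [h2 hE]]|[B [AB nB]]].
  have hh : SLH_mx h *m h = 1%:M.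
    by move: h2; rewrite expg2 => /(congr1 (@SLH_mx R 3)).
  have hr : reversed_by (SLH_mx h) A.
    (* As [h] is its own inverse, the reversing equation becomes a statement about the square of
       [h * A]. *)
    have : (h * A * (h * A) = 1)%g.
      have hV : (h^-1 = h)%g by apply: (mulgI h); rewrite mulgV -h2 expg2.
      by move: hE; rewrite hV mulgA => ->; rewrite mulVg.
    by move=> /(congr1 (@SLH_mx R 3)).
  have [B AB nB] := strongly_reversible_normal_form hh hr.
  have [B' AB' BB'] := conjugate_SLH AB; exists B'; split=> //.
  by apply: normal_form_listed; rewrite BB'.
apply: strongly_reversible_conjugate AB _.
have jinv : mx3 0 (Quat 0 0 1 0) 0 (- Quat 0 0 1 0) 0 0 0 0 1 *m
    mx3 0 (Quat 0 0 1 0) 0 (- Quat 0 0 1 0) 0 0 0 0 1 = 1%:M :> 'M[quat R]_3.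
  by mx3_simp; congr Quat => /=; ring.
case: nB => [[t [psi [_ hpsi BE]]]|[r [t [psi [r0 _ _ hpsi BE]]]]
            |[t [psi [ht hpsi BE]]]|[t [ht BE]]].
- apply: (involution_strongly_reversible jinv); rewrite BE.
  have := @diag_reversed R 1 t _ (oner_neq0 _) (expi_sign hpsi).
  by rewrite invr1 !mul1r.
- apply: (involution_strongly_reversible jinv); rewrite BE.
  by apply: diag_reversed; [rewrite gt_eqF|apply: expi_sign].
- apply: involution_strongly_reversible; last first.
    by rewrite BE; apply: jordan2_reversed; apply: expi_sign.
  by mx3_simp.
- apply: involution_strongly_reversible; last first.
    by rewrite BE; apply: jordan3_reversed; apply: expi_sign.
  by mx3_simp.
Qed.
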